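(* Let $\boldsymbol{\mu}=(\mu_1,\ldots,\mu_n)$ be an $n$-tuple of umbral monomials with generating function $f(\boldsymbol{\mu},\boldsymbol{t}_{(n)})$ and let $\boldsymbol{\nu}=(\nu_1,\ldots,\nu_m)$ be an $m$-tuple of umbral monomials with generating function $f(\boldsymbol{\nu},\boldsymbol{t}_{(m)})$, where $\boldsymbol{t}_{(k)}=(t_1,\dots,t_k)$. Then the auxiliary umbra $(\mu_1+\cdots+\mu_n)\boldsymbol{.}\beta\boldsymbol{.}\boldsymbol{\nu}$ has generating function $$f[(\mu_1+\cdots+\mu_n)\boldsymbol{.}\beta\boldsymbol{.}\boldsymbol{\nu},\,\boldsymbol{t}_{(m)}]=f[\boldsymbol{\mu},(f(\boldsymbol{\nu},\boldsymbol{t}_{(m)})-1,\ldots,f(\boldsymbol{\nu},\boldsymbol{t}_{(m)})-1)],$$ an identity of formal power series in $t_1,\dots,t_m$ (with $n$ equal arguments on the right).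
   Context: $R$ is the real or complex field, $A$ is a set (the alphabet) whose elements are called umbrae, and $E:R[A]\to R$ is a linear functional (evaluation) with $E[1]=1$ and $E[\alpha^i\gamma^j\cdots]=E[\alpha^i]E[\gamma^j]\cdots$ for distinct umbrae and nonnegative integers $i,j,\dots$. A $k$-tuple $\boldsymbol{\mu}=(\mu_1,\dots,\mu_k)$ of umbral monomials (monomials in $R[A]$, supports not necessarily disjoint) has multivariate moments $E[\boldsymbol{\mu}^{\boldsymbol{i}}]$, $\boldsymbol{\mu}^{\boldsymbol{i}}=\mu_1^{i_1}\cdots\mu_k^{i_k}$, $\boldsymbol{i}\in\mathbb{N}_0^k$, and generating function $f(\boldsymbol{\mu},\boldsymbol{t}_{(k)})=1+\sum_{\boldsymbol{i}\neq\boldsymbol{0}}E[\boldsymbol{\mu}^{\boldsymbol{i}}]\,\boldsymbol{t}_{(k)}^{\boldsymbol{i}}/\boldsymbol{i}!$ with $\boldsymbol{i}!=i_1!\cdots i_k!$, $\boldsymbol{t}_{(k)}^{\boldsymbol{i}}=t_1^{i_1}\cdots t_k^{i_k}$. For formal power series $s_1,\dots,s_n$ without constant term, $f[\boldsymbol{\mu},(s_1,\dots,s_n)]$ denotes the substitution $t_j\mapsto s_j$ in $f(\boldsymbol{\mu},\boldsymbol{t}_{(n)})$. Partitions of a multi-index: a partition $\boldsymbol{\lambda}$ of $\boldsymbol{i}\in\mathbb{N}_0^m$, written $\boldsymbol{\lambda}\vdash\boldsymbol{i}$, is a matrix of nonnegative integers with $m$ rows, no zero column, columns in lexicographic order, and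 $r$-th row sum equal to $i_r$ for $r=1,\dots,m$. Its number of columns is $l(\boldsymbol{\lambda})$. Writing $\boldsymbol{\lambda}=(\boldsymbol{\lambda}_1^{r_1},\boldsymbol{\lambda}_2^{r_2},\dots)$ when the distinct column $\boldsymbol{\lambda}_j$ occurs $r_j$ times, set $\mathfrak{m}(\boldsymbol{\lambda})!=r_1!r_2!\cdots$ and $\boldsymbol{\lambda}!=\prod_j(\boldsymbol{\lambda}_j!)^{r_j}$ (product of factorials of all entries). With $h_{\boldsymbol{j}}=E[\boldsymbol{\nu}^{\boldsymbol{j}}]$ set $h_{\boldsymbol{\lambda}}=h_{\boldsymbol{\lambda}_1}^{r_1}h_{\boldsymbol{\lambda}_2}^{r_2}\cdots$. The auxiliary umbra $p\boldsymbol{.}\beta\boldsymbol{.}\boldsymbol{\nu}$ ($\beta$ denotes the Bell umbra), for an umbral polynomial $p\in R[A]$ (here $p=\mu_1+\cdots+\mu_n$), is the symbolic $m$-tuple defined by its moments $$E[(p\boldsymbol{.}\beta\boldsymbol{.}\boldsymbol{\nu})^{\boldsymbol{i}}]=\sum_{\boldsymbol{\lambda}\vdash\boldsymbol{i}}\frac{\boldsymbol{i}!}{\mathfrak{m}(\boldsymbol{\lambda})!\,\boldsymbol{\lambda}!}\,E[p^{\,l(\boldsymbol{\lambda})}]\,h_{\boldsymbol{\lambda}},\qquad \boldsymbol{i}\in\mathbb{N}_0^m,$$ and its generating function is $1+\sum_{\boldsymbol{i}\ne\boldsymbol{0}}E[(p\boldsymbol{.}\beta\boldsymbol{.}\boldsymbol{\nu})^{\boldsymbol{i}}]\,\boldsymbol{t}_{(m)}^{\boldsymbol{i}}/\boldsymbol{i}!$.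 *)

(* Defs.v *)
From HB Require Import structures.
From mathcomp Require Import all_boot all_order all_algebra.
From mathcomp Require Import monalg mpoly.

Set Implicit Arguments.
Unset Strict Implicit.
Unset Printing Implicit Defensive.

Import Order.TTheory GRing.Theory Num.Theory.
Local Open Scope ring_scope.

(* monalg and mpoly both define this notation; multinomials are those of mpoly. *)
Local Notation "{ 'mpoly' T [ n ] }" := (mpoly n T) : type_scope.

(* The polynomial ring R[A] over a possibly infinite alphabet A. *)
Notation umbral_poly R A := {malg R[{cmonom A}]}.

(* Multi-indices in N_0^k are the multinomials 'X_{1..k}. *)
Definition mfact k (i : 'X_{1..k}) : nat := (\prod_(r < k) (i r)`!)%N.

Section Evaluation.
Variables (R : numFieldType) (A : choiceType).

Definition umonomial (u : {cmonom A}) : umbral_poly R A := << u >>.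

Definition umbra (a : A) : umbral_poly R A := umonomial (ucm a).

Definition evaluation (E : {scalar umbral_poly R A}) : Prop :=
  E 1 = 1 /\
  forall (s : seq A) (e : A -> nat), uniq s ->
    E (\prod_(a <- s) umbra a ^+ e a) = \prod_(a <- s) E (umbra a ^+ e a).

Definition moment (E : {scalar umbral_poly R A}) k
    (mu : k.-tuple {cmonom A}) (i : 'X_{1..k}) : R :=
  E (\prod_(r < k) umonomial (tnth mu r) ^+ i r).

End Evaluation.

(* A formal power series in t_1, ..., t_k is given by its coefficients, and    *)
(* equality of series is pointwise equality =1.                                *)
Definition fps (R : numFieldType) (k : nat) := 'X_{1..k} -> R.

Section PowerSeries.
Variable R : numFieldType.

Definition egf k (a : 'X_{1..k} -> R) : fps R k :=
  fun i => if i == 0%MM then 1 else a i / (mfact i)%:R.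

Definition fps_sub1 k (f : fps R k) : fps R k :=
  fun i => f i - (i == 0%MM)%:R.

Definition fps_trunc d k (f : fps R k) : {mpoly R[k]} :=
  \sum_(i : 'X_{1..k < d}) f i *: 'X_[i].

(* If the s_j have no constant term, the monomials of s^j have degree at least *)
(* |j|, so the coefficient of t^i in f(s_1, ..., s_n) only involves terms of   *)
(* degree at most |i| of f and of the s_j; see fps_substE.                     *)
Definition fps_subst n k (f : fps R n) (s : 'I_n -> fps R k) : fps R k :=
  fun i => let d := (mdeg i).+1 in
    (fps_trunc d f \mPo [tuple fps_trunc d (s j) | j < n])@_i.

Lemma mcoeff_fps_trunc d k (f : fps R k) i :
  (fps_trunc d f)@_i = if (mdeg i < d)%N then f i else 0.
Proof.
rewrite /fps_trunc raddf_sum /=; case: ifP => [lti|/negbT nlti].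
  rewrite (bigD1 (BMultinom lti)) //= mcoeffZ mcoeffX eqxx mulr1.
  rewrite big1 ?addr0 // => j /eqP nej; rewrite mcoeffZ mcoeffX.
  case: eqP => [eji|]; last by rewrite mulr0.
  by case: nej; apply: val_inj.
rewrite big1 // => j _; rewrite mcoeffZ mcoeffX.
case: eqP => [eji|]; last by rewrite mulr0.
by case/negP: nlti; rewrite -eji; apply: bmdeg.
Qed.

Lemma mcoeffM_congr k d (p p' q q' : {mpoly R[k]}) :
  (forall i, (mdeg i < d)%N -> p@_i = p'@_i) ->
  (forall i, (mdeg i < d)%N -> q@_i = q'@_i) ->
  forall i, (mdeg i < d)%N -> (p * q)@_i = (p' * q')@_i.
Proof.
move=> hp hq i hi; rewrite !mcoeffM; apply: eq_bigr => j /eqP ej.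
have {}ej : mdeg i = (mdeg j.1 + mdeg j.2)%N by rewrite {1}ej mdegD.
have [hj1 hj2] : (mdeg j.1 <= mdeg i /\ mdeg j.2 <= mdeg i)%N.
  by split; rewrite [leqRHS]ej ?leq_addl ?leq_addr.
by rewrite hp ?hq // (leq_ltn_trans _ hi).
Qed.

Lemma mcoeffM_order k a b (p q : {mpoly R[k]}) :
  (forall i, (mdeg i < a)%N -> p@_i = 0) ->
  (forall i, (mdeg i < b)%N -> q@_i = 0) ->
  forall i, (mdeg i < a + b)%N -> (p * q)@_i = 0.
Proof.
move=> hp hq i hi; rewrite !mcoeffM big1 // => j /eqP ej.
have {}ej : mdeg i = (mdeg j.1 + mdeg j.2)%N by rewrite {1}ej mdegD.
have [lt|le] := ltnP (mdeg j.1) a; first by rewrite hp ?mul0r.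
rewrite hq ?mulr0 // -(ltn_add2l a); apply: leq_ltn_trans hi.
by rewrite [leqRHS]ej leq_add2r.
Qed.

Lemma mcoeff_prodX_order n k (s : 'I_n -> {mpoly R[k]}) (j : 'X_{1..n}) :
  (forall r, (s r)@_0%MM = 0) ->
  forall i, (mdeg i < mdeg j)%N -> (\prod_(r < n) s r ^+ j r)@_i = 0.
Proof.
move=> s0; rewrite mdegE.
elim/big_ind2: _ => [i //|p a q b hp hq|r _]; first exact: mcoeffM_order.
elim: (j r) => [//|e IHe]; rewrite exprS -add1n; apply: mcoeffM_order => //.
by move=> i; rewrite ltnS leqn0 mdeg_eq0 => /eqP->.
Qed.

Lemma fps_substE n k (f : fps R n) (s : 'I_n -> fps R k) d i :
  (forall j, s j 0%MM = 0) -> (mdeg i < d)%N ->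
  (fps_trunc d f \mPo [tuple fps_trunc d (s j) | j < n])@_i = fps_subst f s i.
Proof.
move=> s0 hd; rewrite /fps_subst.
have subst e : (mdeg i < e)%N ->
    (fps_trunc e f \mPo [tuple fps_trunc e (s j) | j < n])@_i =
    \sum_(j : 'X_{1..n < (mdeg i).+1})
       f j * (\prod_(r < n) fps_trunc (mdeg i).+1 (s r) ^+ j r)@_i.
  move=> he; rewrite [fps_trunc e f]/fps_trunc.
  rewrite (raddf_sum (comp_mpoly [tuple fps_trunc e (s j) | j < n])) /=.
  rewrite (raddf_sum (mcoeff i)) /=.
  pose F (j : 'X_{1..n}) :=
    f j * (\prod_(r < n) fps_trunc e (s r) ^+ j r)@_i.
  have F0 j : (mdeg i < mdeg j)%N -> F j = 0.
    move=> hj; rewrite /F mcoeff_prodX_order ?mulr0 // => r.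
    by rewrite mcoeff_fps_trunc s0 if_same.
  transitivity (\sum_(j : 'X_{1..n < e}) F j).
    apply: eq_bigr => j _; rewrite comp_mpolyZ comp_mpolyX mcoeffZ.
    by congr (_ * _@__); apply: eq_bigr => r _; rewrite tnth_mktuple.
  transitivity (\sum_(j : 'X_{1..n < (mdeg i).+1}) F j).
    rewrite (bigID (fun j : 'X_{1..n < e} => (mdeg j < (mdeg i).+1)%N)) /=.
    rewrite [X in _ + X]big1 ?addr0; last first.
      by move=> j; rewrite -leqNgt; apply: F0.
    rewrite (reindex_onto
      (fun j : 'X_{1..n < (mdeg i).+1} =>
         BMultinom (leq_trans (bmdeg j) he) : 'X_{1..n < e})
      (fun j : 'X_{1..n < e} => insubd bm0 (val j))) /=; last first.
      by move=> j hj; apply: val_inj; rewrite /= insubdK.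
    apply: eq_bigl => j; rewrite bmdeg; apply/eqP/val_inj.
    by rewrite insubdK // /in_mem /= bmdeg.
  apply: eq_bigr => j _; congr (_ * _).
  suff H i' : (mdeg i' < (mdeg i).+1)%N ->
      (\prod_(r < n) fps_trunc e (s r) ^+ j r)@_i' =
      (\prod_(r < n) fps_trunc (mdeg i).+1 (s r) ^+ j r)@_i' by exact: H.
  elim/big_ind2: _ i' => [//|p p' q q' hp hq|r _]; first exact: mcoeffM_congr.
  elim: (j r) => [//|a IHa]; rewrite !exprS; apply: mcoeffM_congr => // i' hi'.
  by rewrite !mcoeff_fps_trunc hi' (leq_trans hi' he).
by rewrite !subst.
Qed.

End PowerSeries.

Section Partitions.
Variable m : nat.

(* A matrix with m rows and any number l(L) of columns. *)
Definition npart := {l : nat & 'M[nat]_(m, l)}.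

Definition part_len (L : npart) : nat := tag L.

Definition part_cols (L : npart) : seq 'X_{1..m} :=
  [seq [multinom tagged L r c | r < m] | c <- enum 'I_(part_len L)].

Definition lex_le : rel 'X_{1..m} := fun c1 c2 =>
  ((c1 : seq nat) <= (c2 : seq nat) :> seqlexi nat)%O.

Definition is_part (i : 'X_{1..m}) (L : npart) : bool :=
  [&& 0%MM \notin part_cols L,
      sorted lex_le (part_cols L)
    & [forall r, (\sum_(c < part_len L) tagged L r c)%N == i r]].

(* Since no column vanishes, a partition of i has at most |i| columns, and its *)
(* entries are at most |i|; see mem_parts.                                     *)
Definition parts (i : 'X_{1..m}) : seq npart :=
  let d := (mdeg i).+1 in
  [seq L <- [seq (Tagged (fun l => 'M[nat]_(m, l))
                    (map_mx val (tagged M)) : npart)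
            | M : {l : 'I_d & 'M['I_d]_(m, l)}] | is_part i L].

Definition part_mult_fact (L : npart) : nat :=
  (\prod_(c <- undup (part_cols L)) (count_mem c (part_cols L))`!)%N.

Definition part_fact (L : npart) : nat :=
  (\prod_(r < m) \prod_(c < part_len L) (tagged L r c)`!)%N.

Definition part_prod (R : numFieldType) (h : 'X_{1..m} -> R) (L : npart) : R :=
  \prod_(c <- undup (part_cols L)) h c ^+ count_mem c (part_cols L).

Lemma parts_uniq i : uniq (parts i).
Proof.
rewrite filter_uniq // map_inj_uniq ?enum_uniq //.
move=> [[l hl] M] [[l' hl'] M'] /= e.
have ll' : l = l' by move: (congr1 tag e).
subst l'; rewrite (bool_irrelevance hl hl') in M M' e *.
congr (existT _ _ _).
move/eqP: e; rewrite eq_Tagged /= => /eqP/matrixP e.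
by apply/matrixP => r c; apply: val_inj; move: (e r c); rewrite !mxE.
Qed.

Lemma mem_parts i L : (L \in parts i) = is_part i L.
Proof.
rewrite mem_filter; case: (boolP (is_part i L)) => //= /and3P[nz _ /forallP rs].
case: L nz rs => l M /= nz rs.
have hM r c : (M r c < (mdeg i).+1)%N.
  rewrite ltnS mdegE (bigD1 r) //= -(eqP (rs r)) (bigD1 c) //= -addnA.
  exact: leq_addr.
have hl : (l < (mdeg i).+1)%N.
  rewrite ltnS mdegE -(eq_bigr _ (fun r _ => eqP (rs r))) exchange_big /=.
  rewrite -[X in (X <= _)%N]card_ord -sum1_card; apply: leq_sum => c _.
  rewrite lt0n; apply: contra nz; rewrite sum_nat_eq0 => /forallP c0.
  apply/mapP; exists c; rewrite ?mem_enum //.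
  by apply/mnmP => r; rewrite mnm0E mnmE; apply/esym/eqP/(implyP (c0 r)).
apply/mapP.
exists (Tagged (fun l : 'I_(mdeg i).+1 => 'M['I_(mdeg i).+1]_(m, l))
  ((\matrix_(r, c) Ordinal (hM r c)) : 'M_(m, Ordinal hl))).
  by rewrite mem_enum.
by congr existT; apply/matrixP => r c; rewrite !mxE.
Qed.

End Partitions.

(* The auxiliary umbra p.beta.nu is symbolic: it is its family of moments. *)
Definition bell_dot_moment (R : numFieldType) (A : choiceType)
    (E : {scalar umbral_poly R A}) (p : umbral_poly R A) m
    (nu : m.-tuple {cmonom A}) (i : 'X_{1..m}) : R :=
  \sum_(L <- parts i)
    (mfact i)%:R / (part_mult_fact L * part_fact L)%N%:R
    * E (p ^+ part_len L) * part_prod (moment E nu) L.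

(* Main.v *)
(* With g = f(nu) - 1 and p = mu_1 + ... + mu_n, both sides have i-th          *)
(* coefficient \sum_l E(p^l) / l! * [t^i] g^l. On the right this is the        *)
(* multinomial formula for p^l. On the left, expand g^l as a sum over words of *)
(* l nonzero multi-indices with sum i: sorting such a word gives the columns   *)
(* of a partition L of i, and L is obtained from l! / m(L)! words.             *)

Require Import Defs.
From mathcomp Require Import all_boot all_order all_algebra.
From mathcomp Require Import monalg mpoly.

Set Implicit Arguments.
Unset Strict Implicit.
Unset Printing Implicit Defensive.

Import GRing.Theory Num.Theory.
Local Open Scope ring_scope.

(** Write g = f(nu) - 1 and p = mu_1 + ... + mu_n. Since all n arguments of f(mu) equal g, a term of
    exponent j contributes g^|j|, and summing over |j| = l gives E[p^l]/l! g^l by the multinomial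
    theorem ([scalar_exprn_sum]). The coefficient of t^i in g^l/l! is a sum over the partitions of i
    with l columns ([mcoeff_fps_truncX]); summing over l recovers the moments of the auxiliary
    umbra. Both facts are instances of one count, [sum_words_orbits]. An l-th power of a sum expands
    over words of length l whose weight is invariant under rearrangement, so the words of nonzero
    weight split into orbits, and an orbit has l! divided by the factorials of the multiplicities as
    its size ([size_permutations_mul]). The orbits are indexed by exponents j in the first case, by
    partitions in the second. *)

(** * Counting words by rearrangement orbits *)

(** Letters absent from [s] contribute 0! = 1. *)
Lemma prod_count_fact (T : eqType) (s u : seq T) : uniq u -> {subset s <= u} ->
  (\prod_(x <- undup s) (count_mem x s)`! = \prod_(x <- u) (count_mem x s)`!)%N.
Proof.
move=> Uu sub_su; rewrite [RHS](bigID (fun x => x \in s)) /=.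
rewrite [X in (_ * X)%N]big1 ?muln1 => [|x /count_memPn-> //].
rewrite -[RHS]big_filter; apply: perm_big; apply: uniq_perm.
- exact: undup_uniq.
- exact: filter_uniq.
move=> x; rewrite mem_undup mem_filter andbC.
by case: (boolP (x \in s)) => [/sub_su->|_] //; rewrite andbF.
Qed.

(** The orbit-stabiliser count for rearrangements, by induction on the size: split the
    rearrangements by their first letter. *)
Lemma size_permutations_mul (T : eqType) (s : seq T) :
  (size (permutations s) * \prod_(x <- undup s) (count_mem x s)`! =
   (size s)`!)%N.
Proof.
have [n] := ubnP (size s); elim: n s => // n IHn s lt_s_n.
have [s0|s_gt0] := posnP (size s); first by rewrite (size0nil s0) big_nil.
rewrite (perm_size (permutationsE s_gt0)) size_allpairs_dep sumnE big_map.
rewrite big_distrl /=.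
(* Removing one copy of [x] lowers only its own count, so the product of factorials loses exactly
   the factor [count_mem x s]. These factors later add up to [size s]. *)
have remE x : x \in s -> (size (permutations (rem x s)) *
    \prod_(y <- undup s) (count_mem y s)`! = (size s).-1`! * count_mem x s)%N.
  move=> s_x; have count_gt0 : (0 < count_mem x s)%N by rewrite -has_count has_pred1.
  rewrite -(size_rem s_x) -IHn; last by rewrite size_rem // prednK.
  rewrite -mulnA; congr (_ * _)%N.
  rewrite (@prod_count_fact _ (rem x s) (undup s)) ?undup_uniq //; last first.
    by move=> y /mem_rem; rewrite mem_undup.
  rewrite !(bigD1_seq x) ?undup_uniq ?mem_undup //= mulnAC; congr (_ * _)%N.
    rewrite count_rem s_x /= eqxx subn1 -{1}(prednK count_gt0) factS.
    by rewrite prednK // mulnC.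
  by apply: eq_bigr => y /negPf y_x; rewrite count_rem s_x /= eq_sym y_x subn0.
transitivity (\sum_(x <- undup s) (size s).-1`! * count_mem x s)%N.
  by apply: eq_big_seq => x; rewrite mem_undup => /remE.
rewrite -big_distrr /= -{2}(prednK s_gt0) factS mulnC prednK //; congr (_ * _)%N.
rewrite -[RHS](perm_size (perm_count_undup s)) size_flatten /shape.
rewrite -map_comp sumnE big_map.
by apply: eq_bigr => x _; rewrite /= size_nseq.
Qed.

Fixpoint words (T : Type) (l : nat) (r : seq T) : seq (seq T) :=
  if l is l'.+1 then [seq x :: w | x <- r, w <- words l' r] else [:: [::]].

Lemma mem_words (T : eqType) l (r : seq T) w :
  (w \in words l r) = (size w == l) && all (mem r) w.
Proof.
elim: l w => [|l IHl] [|x w] //=; first by apply/allpairsP => -[[]] ? ? [].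
rewrite eqSS andbCA -IHl; apply/allpairsP/andP => [[[y v] [/=]]|[rx rw]].
  by move=> ry rv [-> ->].
by exists (x, w).
Qed.

Lemma words_uniq (T : eqType) l (r : seq T) : uniq r -> uniq (words l r).
Proof.
move=> Ur; elim: l => //= l IHl; apply: allpairs_uniq => //.
by move=> [x v] [y w] _ _ [-> ->].
Qed.

Lemma exprn_sum_words (S : pzSemiRingType) (T : Type) (F : T -> S) l (r : seq T) :
  (\sum_(x <- r) F x) ^+ l = \sum_(w <- words l r) \prod_(x <- w) F x.
Proof.
elim: l => [|l IHl]; first by rewrite big_seq1 big_nil.
rewrite exprS IHl big_distrl big_allpairs_dep /=; apply: eq_bigr => x _.
by rewrite big_distrr /=; apply: eq_bigr => w _; rewrite big_cons.
Qed.

(* The words on which G is supported are the rearrangements of the w s, each   *)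
(* w s having l! / \prod_x (count_mem x (w s))! of them.                       *)
Lemma sum_words_orbits (R : numFieldType) (T I : eqType) l (r : seq T)
    (G : seq T -> R) (S : seq I) (w : I -> seq T) :
  uniq r -> uniq S -> (forall v v', perm_eq v v' -> G v = G v') ->
  {in S, forall s, w s \in words l r} ->
  {in S &, forall s s', perm_eq (w s) (w s') -> s = s'} ->
  {in words l r, forall v, G v != 0 -> exists2 s, s \in S & perm_eq v (w s)} ->
  \sum_(v <- words l r) G v / l`!%:R =
  \sum_(s <- S)
     G (w s) / (\prod_(x <- undup (w s)) (count_mem x (w s))`!)%N%:R.
Proof.
move=> Ur US permG wS injw surjw.
transitivity (\sum_(s <- S) \sum_(v <- permutations (w s)) G v / l`!%:R); last first.
  apply: eq_big_seq => s sS; have:= wS s sS; rewrite mem_words => /andP[/eqP sz _].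
  rewrite (eq_big_seq (fun=> G (w s) / l`!%:R)); last first.
    by move=> v; rewrite mem_permutations => /permG->.
  rewrite big_const_seq count_predT iter_addr_0 -sz.
  rewrite -(size_permutations_mul (w s)) natrM.
  set a := size _; set b := (\prod_(_ <- _) _)%N.
  (* The orbit size [a] divides a factorial, so it is nonzero and cancels. *)
  have /eqP: (a * b)%N != 0%N by rewrite size_permutations_mul -lt0n fact_gt0.
  move/eqP; rewrite muln_eq0 negb_or => /andP[a0 _].
  by rewrite -[LHS]mulr_natr invfM mulrA mulrAC mulfVK ?pnatr_eq0.
rewrite -(big_allpairs_dep (h := fun s v => v) (F := fun v => G v / l`!%:R)).
set P := [seq _ | _ <- _, _ <- _].
(* The orbits are disjoint by [injw], so no word is counted twice. *)
have UP : uniq P.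
  apply: allpairs_uniq_dep => // [s _|]; first exact: permutations_uniq.
  move=> _ _ /allpairsPdep[s [v [sS vs ->]]]
    /allpairsPdep[s' [v' [sS' vs' ->]]] /= vv'.
  subst v'; move: vs vs' => /=; rewrite !mem_permutations => vs vs'.
  have ss' : s = s' by apply: injw => //; rewrite -(permPl vs).
  by rewrite ss'.
(* By [surjw], a word outside every orbit has weight zero. *)
rewrite (bigID (fun x => x \in P)) /= addrC big1_seq ?add0r.
  rewrite -[LHS]big_filter; apply: perm_big; apply: uniq_perm => //.
    by rewrite filter_uniq // words_uniq.
  move=> v; rewrite mem_filter andb_idr // => /allpairsPdep[s [v' [sS + ->]]].
  rewrite mem_permutations => vs; have:= wS s sS; rewrite !mem_words.
  by rewrite (perm_size vs) (perm_all _ vs).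
move=> v /andP[vP vW]; case: (eqVneq (G v) 0) => [->|/(surjw v vW)[s sS vs]].
  by rewrite mul0r.
by case/allpairsPdep: vP; exists s, v; rewrite mem_permutations.
Qed.

(** * The multinomial theorem under a linear functional *)

(** The nondecreasing word with letter counts [j], chosen to represent its rearrangement orbit. *)
Definition letters n (j : 'X_{1..n}) : seq 'I_n :=
  flatten [seq nseq (j r) r | r <- enum 'I_n].

Lemma count_letters n (j : 'X_{1..n}) r : count_mem r (letters j) = j r.
Proof.
rewrite count_flatten -map_comp sumnE big_map big_enum (bigD1 r) //=.
rewrite count_nseq /= eqxx mul1n big1 ?addn0 // => s /negPf s_r.
by rewrite count_nseq /= s_r.
Qed.

Lemma size_letters n (j : 'X_{1..n}) : size (letters j) = mdeg j.
Proof.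
rewrite size_flatten /shape -map_comp sumnE big_map big_enum mdegE.
by apply: eq_bigr => r _; rewrite /= size_nseq.
Qed.

Lemma prod_letters (S : comPzSemiRingType) n (x : 'I_n -> S) (j : 'X_{1..n}) :
  \prod_(r <- letters j) x r = \prod_(r < n) x r ^+ j r.
Proof.
rewrite big_flatten big_map big_enum; apply: eq_bigr => r _.
by rewrite big_nseq iter_mulr_1.
Qed.

Lemma prod_fact_letters n (j : 'X_{1..n}) :
  (\prod_(r <- undup (letters j)) (count_mem r (letters j))`!)%N = mfact j.
Proof.
rewrite (@prod_count_fact _ _ (enum 'I_n)) ?enum_uniq => [||r _].
- by rewrite big_enum; apply: eq_bigr => r _; rewrite count_letters.
- by [].
by rewrite mem_enum.
Qed.

(** Words in the indices 1, ..., n are classified up to rearrangement by their letter counts. The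
    bound [d] only makes the index type finite; [l < d] ensures that no exponent of degree [l] is
    lost. *)
Lemma scalar_exprn_sum (R : numFieldType) (S : comAlgType R) (E : {scalar S})
    n (x : 'I_n -> S) l d : (l < d)%N ->
  E ((\sum_(r < n) x r) ^+ l) / l`!%:R =
  \sum_(j : 'X_{1..n < d} | mdeg j == l)
     E (\prod_(r < n) x r ^+ j r) / (mfact j)%:R.
Proof.
move=> lt_l_d; rewrite -[in LHS]big_enum /= exprn_sum_words raddf_sum mulr_suml.
pose deg_l := [seq j : 'X_{1..n < d} <- enum {: 'X_{1..n < d}} | mdeg j == l].
rewrite (@sum_words_orbits R _ _ l (enum 'I_n)
  (fun v => E (\prod_(r <- v) x r)) deg_l (fun j => letters j)).
- rewrite big_filter big_enum_cond; apply: eq_bigr => j _.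
  by rewrite prod_letters prod_fact_letters.
- exact: enum_uniq.
- by rewrite filter_uniq ?enum_uniq.
- by move=> v v' vv'; congr (E _); apply: perm_big.
- move=> j; rewrite mem_filter mem_words size_letters => /andP[-> _].
  by apply/allP => r _; apply: mem_enum.
- move=> j j' _ _ /permP jj'; apply/val_inj/mnmP => r.
  by rewrite -!count_letters jj'.
move=> v; rewrite mem_words => /andP[/eqP sz _] _.
pose j := [multinom count_mem r v | r < n].
have vj : perm_eq v (letters j).
  by apply/allP => r _; apply/eqP; rewrite /= count_letters mnmE.
have lt_j_d : (mdeg j < d)%N by rewrite -size_letters -(perm_size vj) sz.
exists (BMultinom lt_j_d) => //.
by rewrite mem_filter mem_enum andbT /= -size_letters -(perm_size vj) sz.
Qed.

(** * Partitions as sorted lists of columns *)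

Section LexOrder.
Variable m : nat.

Lemma lex_le_total : total (@lex_le m).
Proof. by move=> c c'; apply: Order.TotalTheory.le_total. Qed.

Lemma lex_le_trans : transitive (@lex_le m).
Proof. by move=> c c' c''; apply: Order.POrderTheory.le_trans. Qed.

Lemma lex_le_anti : antisymmetric (@lex_le m).
Proof.
by move=> c c' /Order.POrderTheory.le_anti/val_inj/val_inj.
Qed.

End LexOrder.

Definition part_of_cols m (s : seq 'X_{1..m}) : npart m :=
  Tagged (fun l => 'M[nat]_(m, l)) (\matrix_(r < m, c < size s) nth 0%MM s c r).

Section PartCols.
Variables (m : nat).
Implicit Types (L : npart m) (i : 'X_{1..m}).

Lemma size_part_cols L : size (part_cols L) = part_len L.
Proof. by rewrite size_map size_enum_ord. Qed.

Lemma part_colsK (s : seq 'X_{1..m}) : part_cols (part_of_cols s) = s.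
Proof.
apply: (@eq_from_nth _ 0%MM); first by rewrite size_part_cols.
rewrite size_part_cols => c lt_c_s.
rewrite (nth_map (Ordinal lt_c_s)) ?size_enum_ord //.
by apply/mnmP => r; rewrite mnmE mxE nth_enum_ord.
Qed.

Lemma part_cols_inj : injective (@part_cols m).
Proof.
move=> [l M] [l' M'] eqMM'.
have ll' : l = l' by move: (congr1 size eqMM'); rewrite !size_part_cols.
subst l'; congr existT; apply/matrixP => r c.
move/eq_in_map: eqMM' => /(_ c); rewrite mem_enum => /(_ isT)/mnmP/(_ r).
by rewrite !mnmE.
Qed.

Lemma big_part_cols (V : Type) (idx : V) (op : Monoid.com_law idx)
    (F : 'X_{1..m} -> V) L :
  \big[op/idx]_(c <- part_cols L) F c =
  \big[op/idx]_(c < part_len L) F [multinom tagged L r c | r < m].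
Proof. by rewrite big_map big_enum. Qed.

(** The row sums are the coordinates of the sum of the columns, so a partition can be handled as a
    sorted list of nonzero multi-indices. *)
Lemma is_partE i L :
  is_part i L = [&& 0%MM \notin part_cols L, sorted (@lex_le m) (part_cols L)
                  & (\sum_(c <- part_cols L) c)%MM == i].
Proof.
rewrite /is_part; do 2!congr andb; apply/forallP/eqP => [row_sum|<- r].
  apply/mnmP => r; rewrite -(eqP (row_sum r)) mnm_sumE big_part_cols.
  by apply: eq_bigr => c _; rewrite mnmE.
apply/eqP; rewrite mnm_sumE big_part_cols.
by apply: eq_bigr => c _; rewrite mnmE.
Qed.

Lemma part_len_le i L : is_part i L -> (part_len L <= mdeg i)%N.
Proof.
rewrite is_partE -size_part_cols => /and3P[nz _ /eqP<-].
rewrite mdeg_sum -sum1_size [leqLHS]big_seq [leqRHS]big_seq.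
apply: leq_sum => c c_L.
by rewrite lt0n mdeg_eq0; apply: contraNneq nz => <-.
Qed.

Lemma part_factE L : part_fact L = (\prod_(c <- part_cols L) mfact c)%N.
Proof.
rewrite /part_fact exchange_big big_part_cols; apply: eq_bigr => c _.
by apply: eq_bigr => r _; rewrite mnmE.
Qed.

Lemma part_prodE (R : numFieldType) (h : 'X_{1..m} -> R) L :
  part_prod h L = \prod_(c <- part_cols L) h c.
Proof.
rewrite -big_undup_iterop_count; apply: eq_bigr => c _.
by rewrite Monoid.iteropE iter_mulr_1.
Qed.

End PartCols.

(** * Powers of a series and comparison of coefficients *)

(** The Faa di Bruno expansion of a power. A word of multi-indices contributes to t^i only if its
    letters sum to [i], and contributes nothing if 0 is a letter, as [g] has no constant term;
    sorting any other such word yields the columns of a partition. *)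
Lemma mcoeff_fps_truncX (R : numFieldType) m d (g : fps R m) l i :
  g 0%MM = 0 -> (mdeg i < d)%N ->
  (fps_trunc d g ^+ l)@_i / l`!%:R =
  \sum_(L <- parts i | part_len L == l)
     (\prod_(c <- part_cols L) g c) / (part_mult_fact L)%:R.
Proof.
move=> g0 lt_i_d.
pose r := [seq val c | c : 'X_{1..m < d}].
have mem_r c : (c \in r) = (mdeg c < d)%N.
  apply/mapP/idP => [[c' _ ->]|lt_c_d]; first exact: bmdeg.
  by exists (BMultinom lt_c_d); rewrite ?mem_enum.
pose G (v : seq 'X_{1..m}) := (\prod_(c <- v) (g c *: 'X_[c] : mpoly m R))@_i.
have GE v : G v = (\prod_(c <- v) g c) * ((\sum_(c <- v) c)%MM == i)%:R.
  by rewrite /G scaler_prod mcoeffZ mpolyX_prod mcoeffX.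
have -> : fps_trunc d g = \sum_(c <- r) g c *: 'X_[c] by rewrite big_map big_enum.
rewrite exprn_sum_words raddf_sum mulr_suml -/(G _).
pose S := [seq L <- parts i | part_len L == l].
have memS L : L \in S -> [/\ part_len L = l, 0%MM \notin part_cols L,
    sorted (@lex_le m) (part_cols L) & (\sum_(c <- part_cols L) c)%MM = i].
  rewrite mem_filter mem_parts is_partE => /andP[/eqP-> /and3P[-> -> /eqP->]].
  by [].
rewrite (@sum_words_orbits R _ _ l r G S (@part_cols m)).
- rewrite big_filter big_seq_cond [RHS]big_seq_cond; apply: eq_bigr => L /andP[].
  rewrite mem_parts is_partE => /and3P[_ _ /eqP sumL] _.
  by rewrite GE sumL eqxx mulr1.
- by rewrite map_inj_uniq ?enum_uniq //; apply: val_inj.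
- by rewrite filter_uniq ?parts_uniq.
- by move=> v v' vv'; rewrite /G; congr (_@__); apply: perm_big.
- move=> L /memS[sz _ _ sumL]; rewrite mem_words size_part_cols sz eqxx /=.
  (* A column is a summand of [i], so its degree stays below the truncation bound. *)
  apply/allP => c cL; rewrite -[_ c]/(c \in r) mem_r; apply: leq_ltn_trans lt_i_d.
  by rewrite -sumL mdeg_sum (big_rem c) //= leq_addr.
(* Two sorted rearrangements of the same columns coincide, and the columns determine the matrix. *)
- move=> L L' /memS[_ _ sL _] /memS[_ _ sL' _] LL'; apply: part_cols_inj.
  exact: (sorted_eq (@lex_le_trans m) (@lex_le_anti m)).
move=> v; rewrite mem_words => /andP[/eqP sz _] Gv.
have perm_v := permEl (perm_sort (@lex_le m) v).
exists (part_of_cols (sort (@lex_le m) v)); last by rewrite part_colsK perm_sym.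
rewrite mem_filter mem_parts is_partE part_colsK -size_part_cols part_colsK.
rewrite size_sort sz eqxx mem_sort sort_sorted ?(perm_big _ perm_v) /=; last first.
  exact: lex_le_total.
move: Gv; rewrite GE mulf_eq0 negb_or pnatr_eq0 eqb0 negbK => /andP[g_v ->].
by rewrite andbT; apply: contra g_v => v0; rewrite (big_rem _ v0) /= g0 mul0r.
Qed.

Theorem theorem3p4 (R : numFieldType) (A : choiceType)
    (E : {scalar umbral_poly R A}) (hE : evaluation E)
    (n m : nat) (mu : n.-tuple {cmonom A}) (nu : m.-tuple {cmonom A}) :
  egf (bell_dot_moment E (\sum_(j < n) umonomial R (tnth mu j)) nu) =1
  fps_subst (egf (moment E mu)) (fun _ : 'I_n => fps_sub1 (egf (moment E nu))).
Proof.
move=> i; set p := \sum_(j < n) _; set g := fps_sub1 _.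
have [E1 _] := hE.
pose d := (mdeg i).+1.
have g0 : g 0%MM = 0 by rewrite /g /fps_sub1 /egf eqxx subrr.
(* The constant term, set to 1 in [egf], agrees with the zeroth moment because E[1] = 1. *)
have egf_mu (j : 'X_{1..n}) : egf (moment E mu) j = moment E mu j / (mfact j)%:R.
  rewrite /egf; case: eqP => // ->; rewrite /moment /mfact.
  by rewrite !big1 ?E1 ?divr1 // => r _; rewrite mnm0E.
have rhsE : fps_subst (egf (moment E mu)) (fun=> g) i =
    \sum_(l < d) E (p ^+ l) / l`!%:R * (fps_trunc d g ^+ l)@_i.
  rewrite /fps_subst -/d {1}/fps_trunc.
  rewrite (raddf_sum (comp_mpoly [tuple fps_trunc d g | j < n])) raddf_sum /=.
  (* Exponents are grouped by total degree [l], on which the power of [g] alone depends. *)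
  rewrite (partition_big (fun j : 'X_{1..n < d} => Ordinal (bmdeg j)) predT) //=.
  apply: eq_bigr => l _; rewrite (@scalar_exprn_sum _ _ E _ _ _ d) // mulr_suml.
  apply: eq_big => [j|j /eqP <-]; first by rewrite -val_eqE.
  rewrite comp_mpolyZ comp_mpolyX mcoeffZ egf_mu /=; congr (_ * _@__).
  rewrite mdegE -prodrXr; apply: eq_bigr => r _.
  by rewrite tnth_mktuple.
rewrite rhsE.
have [i0|i_neq0] := eqVneq i 0%MM.
  rewrite /d /egf i0 eqxx mdeg0 big_ord1 !expr0 E1 mcoeff1 eqxx.
  by rewrite fact0 !divr1 mulr1.
rewrite /egf (negPf i_neq0) /bell_dot_moment mulr_suml.
transitivity (\sum_(L <- parts i) E (p ^+ part_len L) *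
    ((\prod_(c <- part_cols L) g c) / (part_mult_fact L)%:R)).
  apply: eq_big_seq => L; rewrite mem_parts is_partE => /and3P[nz _ _].
  have -> : \prod_(c <- part_cols L) g c =
      part_prod (moment E nu) L / (part_fact L)%:R.
    rewrite part_prodE part_factE natr_prod -prodf_div.
    apply: eq_big_seq => c c_L; have /negPf c0 : c != 0%MM.
      by apply: contraNneq nz => <-.
    by rewrite /g /fps_sub1 /egf c0 subr0.
  rewrite natrM invfM -!mulrA [LHS]mulrC -!mulrA mulVf ?mulr1; last first.
    by rewrite pnatr_eq0 -lt0n prodn_gt0 // => r; apply: fact_gt0.
  by rewrite mulrA [RHS]mulrA [LHS]mulrC (mulrC _^-1).
(* The right side is now grouped by number of columns. By [part_len_le] this number is at most |i| <
   [d], so each partition lies in exactly one group. *)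
rewrite (eq_bigr (fun l : 'I_d => \sum_(L <- parts i | part_len L == l)
   E (p ^+ part_len L) *
    ((\prod_(c <- part_cols L) g c) / (part_mult_fact L)%:R))); last first.
  move=> l _; rewrite mulrAC -mulrA mcoeff_fps_truncX // mulr_sumr.
  by apply: eq_bigr => L /eqP->.
rewrite (exchange_big_dep predT) //=; apply: eq_big_seq => L.
rewrite mem_parts => /part_len_le; rewrite -ltnS => lt_L_d.
by rewrite (big_pred1 (Ordinal lt_L_d)).
Qed.
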